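(* Let $N,d\ge1$ be integers and, for $j,k=1,\dots,N$, let $u_{jk}:[0,+\infty)\to[0,+\infty)$ be Lebesgue measurable and bounded. Let $G$ be the directed graph with nodes $\{1,\dots,N\}$ in which there is an arrow from node $j$ to node $k$ if one of the following (equivalent) properties holds: 1. $\displaystyle\limsup_{T\to+\infty}\ \liminf_{t\to+\infty}\int_t^{t+T}u_{jk}(s)\,ds>0$; 2. there exist $T,\mu>0$ such that $\displaystyle\int_t^{t+T}u_{jk}(s)\,ds\ge\mu$ for all $t\ge0$; 3. there exist $T,\mu>0$ and a sequence $t_n\to+\infty$ in $[0,+\infty)$ with $\{t_{n+1}-t_n\}_{n\in\mathbb N}$ bounded such that $\displaystyle\int_{t_n}^{t_n+T}u_{jk}(s)\,ds\ge\mu$ for all $n\in\mathbb N$. Assume that $G$ has a globally reachable node. Then, for every initial configuration $(x_1(0),\dots,x_N(0))\in(\mathbb R^d)^N$, the solution of $$\dot x_j=\sum_{k=1}^{N}u_{jk}(t)\,(x_k-x_j),\qquad j=1,\dots,N,$$ converges to consensus.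
   Context: Globally reachable node: a node $\ell^*$ of a directed graph is globally reachable if for every node $i$ there is a directed path of arrows $i\to j_1\to\dots\to\ell^*$. Solutions are in the Carathéodory sense: $x_j:[0,+\infty)\to\mathbb R^d$ is absolutely continuous on compact intervals and the equation holds for almost every $t$. Consensus: a solution converges to consensus if there exists $x^*\in\mathbb R^d$ with $\lim_{t\to+\infty}x_j(t)=x^*$ for all $j=1,\dots,N$. *)

(* Defs.v *)
From HB Require Import structures.
From mathcomp Require Import all_boot all_order all_algebra.
From mathcomp Require Import all_classical all_reals all_analysis.

Set Implicit Arguments.
Unset Strict Implicit.
Unset Printing Implicit Defensive.
Import Order.TTheory GRing.Theory Num.Theory.
Import numFieldNormedType.Exports.

Local Open Scope classical_set_scope.
Local Open Scope ring_scope.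

(* The real line with the sigma-algebra of Lebesgue (not just Borel)
   measurable sets; this is the domain of completed_lebesgue_measure. *)
Notation lebesgueTypeR R :=
  (caratheodory_type (wlength (@idfun R))^*%mu).

(* Functions on [0, +oo[ are represented by total functions on R of which only
   the values on [0, +oo[ are constrained or used. *)
Definition lebesgue_measurable_halfline (R : realType) (f : R -> R) : Prop :=
  @measurable_fun _ _ (lebesgueTypeR R) (measurableTypeR R) `[0, +oo[ f.

Section persistent_excitation.
Variables (R : realType) (f : R -> R).

(* An extended real, so that the limits below need no finiteness proviso. *)
Definition window_integral (t T : R) : \bar R :=
  (\int[@completed_lebesgue_measure R]_(s in `[t, (t + T)%R]) (f s)%:E)%E.

Definition excited_limsup : Prop :=
  (0 < limf_esup (fun T : R =>
         limf_einf (fun t : R => window_integral t T) (pinfty_nbhs R))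
       (pinfty_nbhs R))%E.

Definition excited_uniform : Prop :=
  exists T mu : R, [/\ 0 < T, 0 < mu &
    forall t : R, 0 <= t -> (mu%:E <= window_integral t T)%E].

Definition excited_sequence : Prop :=
  exists (T mu : R) (t_ : nat -> R),
    [/\ 0 < T, 0 < mu, forall n, 0 <= t_ n & t_ n @[n --> \oo] --> +oo] /\
    bounded_fun (fun n => t_ n.+1 - t_ n) /\
    (forall n, (mu%:E <= window_integral (t_ n) T)%E).

Definition excited : Prop :=
  [\/ excited_limsup, excited_uniform | excited_sequence].

End persistent_excitation.

(* The path from the node [l] to itself may be empty. *)
Definition globally_reachable (T : finType) (arrow : T -> T -> Prop) (l : T)
    : Prop :=
  forall i : T, connect [rel j k | `[< arrow j k >]] i l.

Definition absolutely_continuous_on (R : realType) (V : normedModType R)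
    (a b : R) (f : R -> V) : Prop :=
  forall e : R, 0 < e -> exists2 delta : R, 0 < delta &
    forall (n : nat) (l r : 'I_n -> R),
      (forall i, a <= l i /\ l i <= r i /\ r i <= b) ->
      trivIset setT (fun i => `]l i, r i[%classic) ->
      \sum_(i < n) (r i - l i) < delta ->
      \sum_(i < n) `|f (r i) - f (l i)| < e.

(* The null set {0} is left out of the almost-everywhere condition, because the
   two-sided derivative at 0 would involve values at negative times.
   The sup norm of 'rV[R]_d is used; the choice of norm is immaterial. *)
Definition caratheodory_solution (R : realType) (N d : nat)
    (u : 'I_N -> 'I_N -> R -> R) (x : 'I_N -> R -> 'rV[R]_d) : Prop :=
  (forall (j : 'I_N) (a b : R), 0 <= a -> a <= b ->
     absolutely_continuous_on a b (x j)) /\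
  {ae @completed_lebesgue_measure R, forall t : R, 0 < t -> forall j : 'I_N,
     is_derive t 1 (x j) (\sum_(k < N) u j k t *: (x k t - x j t))}.

Definition converges_to_consensus (R : realType) (N d : nat)
    (x : 'I_N -> R -> 'rV[R]_d) : Prop :=
  exists xstar : 'rV[R]_d, forall j : 'I_N, x j t @[t --> +oo] --> xstar.

(* Main.v *)
Require Import Defs.
From mathcomp Require Import all_boot all_order all_algebra.
From mathcomp Require Import all_classical all_reals all_analysis.
From mathcomp Require Import measurable_realfun.
From mathcomp Require Import ring lra.

Set Implicit Arguments.
Unset Strict Implicit.
Unset Printing Implicit Defensive.
Import Order.TTheory GRing.Theory Num.Theory.
Import numFieldNormedType.Exports.
Local Open Scope classical_set_scope.
Local Open Scope ring_scope.

(* Each coordinate of a solution is a scalar solution.  For a scalar solution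
   the minimum of the components is nondecreasing and the maximum nonincreasing,
   so that, up to an affine change of unknown, all components are nonnegative.
   Then e^{Kt} x_i increases at a rate at least u_ik x_k, where K bounds the row
   sums of u: a lower bound on x_k over an excited window becomes one on x_i.
   Propagating along paths to the globally reachable node l, every component
   feels x_l within a fixed delay.  As x_l lies in one half of the current range
   [m, M], the range shrinks by a fixed factor over that delay.

   No fundamental theorem of calculus is used: an absolutely continuous function
   whose derivative is a.e. nonnegative, and at least c off a set of measure v,
   grows by at least c (b - a - v) on [a, b].  This suffices because a window
   integral at least mu of a function with values in [0, B] forces the function
   to be at least mu / 2T on a set of measure at least mu / 2B. *)

(** * Growth of absolutely continuous functions from lower bounds on slopes *)

Notation outer_lebesgue := (@wlength _ idfun)^*%mu.

(** Some point satisfying [P] lies at or just below the supremum of all such points; the step at the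
    supremum carries [P] beyond it, unless it is already [b]. Asking only for [y <= x <= z] matches
    intervals tagged by [x]. *)
Lemma segment_induction (R : realType) (P : R -> Prop) (a b : R) :
  a <= b -> P a ->
  (forall x, a <= x -> x <= b -> exists2 e, 0 < e &
    forall y z, a <= y -> y <= x -> x <= z -> z <= b ->
      x - e < y -> z < x + e -> P y -> P z) ->
  P b.
Proof.
move=> ab Pa step.
pose S := [set x | [/\ a <= x, x <= b & P x]].
have Sa : S a by split.
have hS : has_sup S by split; [exists a | exists b => x []].
have as_ : a <= sup S by exact: ub_le_sup hS.2 _ Sa.
have sb : sup S <= b by apply: ge_sup => [|x []//]; exists a.
have [e e0 Hs] := step _ as_ sb.
have [y [ay yb Py] sy] := sup_adherent e0 hS.
have ys : y <= sup S by apply: ub_le_sup hS.2 _ _; split.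
have step' z : sup S <= z -> z <= b -> z < sup S + e -> P z.
  by move=> sz zb ze; exact: (Hs y z).
have [bs|bs] := ltP b (sup S + e); first exact: step'.
have e2 : sup S + e / 2 < sup S + e by rewrite ltrD2l; lra.
have Sz : S (sup S + e / 2).
  by split; [lra|lra|apply: step' => //; lra].
have := ub_le_sup hS.2 Sz; lra.
Qed.

(* [psi t] is the measure of [W `&` `]a, t]]. *)
Lemma open_length (R : realType) (W : set R) (a v : R) :
  open W -> (lebesgue_measure W <= v%:E)%E ->
  exists psi : R -> R, [/\ psi a = 0,
    forall t, psi t <= v,
    forall y z, a <= y -> y <= z -> psi y <= psi z &
    forall y z, a <= y -> y <= z -> `]y, z] `<=` W -> psi z - psi y = z - y].
Proof.
move=> oW Wv.
have mW : measurable (W : set (measurableTypeR R)) by exact: open_measurable.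
have mI y z : measurable (W `&` `]y, z] : set (measurableTypeR R)).
  exact: measurableI.
have leWv y z : (lebesgue_measure (W `&` `]y, z]%classic) <= v%:E)%E.
  by rewrite (le_trans _ Wv)// le_measure ?inE//; exact: subIsetl.
have fin y z : lebesgue_measure (W `&` `]y, z]%classic) \is a fin_num.
  by rewrite ge0_fin_numE// (le_lt_trans (leWv y z))// ltry.
pose psi t := fine (lebesgue_measure (W `&` `]a, t]%classic)).
have psiB y z : a <= y -> y <= z ->
    psi z = psi y + fine (lebesgue_measure (W `&` `]y, z]%classic)).
  move=> ay yz; rewrite /psi -fineD//; congr fine.
  rewrite -measureU//; last first.
    by rewrite -subset0 => t [[_] + [_]]; rewrite /= !in_itv/=; lra.
  rewrite -setIUr; congr (lebesgue_measure (W `&` _)).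
  apply/seteqP; split => t /=; rewrite !in_itv/=; last by case; lra.
  by move=> ?; case: (ltP y t) => ?; [right|left]; lra.
exists psi; split.
- by rewrite /psi set_itv_ge ?bnd_simp ?ltxx// setI0 measure0.
- by move=> t; rewrite -lee_fin /psi fineK.
- by move=> y z ay yz; rewrite (psiB y z)// lerDl fine_ge0.
- move=> y z ay yz sub; rewrite (psiB y z)// addrAC subrr add0r.
  rewrite (setIidr sub) lebesgue_measure_itv/= lte_fin.
  by case: ltgtP yz => //= -> _; rewrite subrr.
Qed.

Lemma outer_lebesgue_open (R : realType) (A : set R) (v e : R) : 0 < e ->
  (outer_lebesgue A <= v%:E)%E ->
  exists W, [/\ open W, A `<=` W & (lebesgue_measure W <= (v + e)%:E)%E].
Proof.
move=> e0 Av; have [W [oW AW We]] := outer_measure_open_le A e0.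
by exists W; split => //; rewrite (le_trans We)// EFinD leeD2r.
Qed.

Lemma open_gauge (R : realType) (W : set R) (x : R) : open W -> W x ->
  exists2 e, 0 < e & forall y z, x - e < y -> z < x + e -> `]y, z] `<=` W.
Proof.
move=> oW Wx; have /nbhs_ballP[e /= e0 We] := open_nbhs_nbhs (conj oW Wx).
exists e => // y z xy zx t /=; rewrite in_itv/= => /andP[yt tz].
by apply: We; rewrite /ball/= ltr_norml; apply/andP; split; lra.
Qed.

(** Both lower Dini derivatives of [f] at [x] are at least [c], written without quotients.
    Differentiability is not asked for, since a minimum of several components may fail to have
    it. *)
Definition slope_ge (R : realType) (f : R -> R) (x c : R) : Prop :=
  forall e : R, 0 < e -> \forall w \near x,
    (x <= w -> (c - e) * (w - x) <= f w - f x) /\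
    (w <= x -> (c - e) * (x - w) <= f x - f w).

Lemma slope_ge_gauge (R : realType) (f : R -> R) (x c e : R) : 0 < e ->
  slope_ge f x c -> exists2 d, 0 < d &
    forall y z, y <= x -> x <= z -> x - d < y -> z < x + d ->
      (c - e) * (z - y) <= f z - f y.
Proof.
move=> e0 /(_ _ e0)/nbhs_ballP[d /= d0 H]; exists d => // y z yx xz dy zd.
have [|+ _] := H z; first by rewrite /ball/= ltr_norml; apply/andP; split; lra.
have [|_ +] := H y; first by rewrite /ball/= ltr_norml; apply/andP; split; lra.
by move=> /(_ yx) ? /(_ xz) ?; lra.
Qed.

Lemma is_derive_expansion (R : realType) (f : R -> R) (x D e : R) : 0 < e ->
  is_derive x 1 f D -> \forall w \near x, `|f w - f x - D * (w - x)| <= e * `|w - x|.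
Proof.
move=> e0 [df Df].
have : (fun h => h^-1 *: (f (h *: 1 + x) - f x)) @ 0^' --> D.
  by rewrite -Df; exact: df.
move/cvgrPdist_le => /(_ _ e0) /=.
move=> /nbhs_ballP[d /= d0 H].
apply/nbhs_ballP; exists d => //= w xw.
have [->|wx] := eqVneq w x; first by rewrite !subrr mulr0 subrr normr0 mulr0.
have wx0 : w - x != 0 by rewrite subr_eq0.
have := H (w - x); rewrite /ball/= sub0r opprB => /(_ xw wx0).
have -> : (w - x) *: (1:R) + x = w by rewrite /GRing.scale/= mulr1 subrK.
move=> h.
have -> : f w - f x - D * (w - x) =
    - (D - (w - x)^-1 *: (f w - f x)) * (w - x).
  by rewrite /GRing.scale/=; field.
by rewrite normrM normrN ler_wpM2r.
Qed.

Lemma is_derive_slope_ge (R : realType) (f : R -> R) (x D c : R) :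
  is_derive x 1 f D -> c <= D -> slope_ge f x c.
Proof.
move=> fD cD e e0; have := is_derive_expansion e0 fD.
apply: filterS => w; rewrite ler_norml => /andP[l r].
split=> xw; move: l r.
- by rewrite ger0_norm ?subr_ge0// => l r; nra.
- by rewrite ler0_norm ?subr_le0// => l r; nra.
Qed.

(** A list, with the rightmost interval first, is extended by a single [::] in an induction, unlike
    a family indexed by ['I_n]; its order makes the open intervals disjoint. *)
Lemma absolutely_continuous_seq (R : realType) (V : normedModType R) (a b : R)
    (f : R -> V) (e : R) :
  absolutely_continuous_on a b f -> 0 < e ->
  exists2 d, 0 < d & forall s : seq (R * R),
    all (fun p => [&& a <= p.1, p.1 <= p.2 & p.2 <= b]) s ->
    pairwise (fun p q => q.2 <= p.1) s ->
    \sum_(p <- s) (p.2 - p.1) < d ->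
    \sum_(p <- s) `|f p.2 - f p.1| < e.
Proof.
move=> acf e0; have [d d0 H] := acf _ e0; exists d => // s sab ps.
pose l (i : 'I_(size s)) := (nth (0, 0) s i).1.
pose r (i : 'I_(size s)) := (nth (0, 0) s i).2.
have h := H (size s) l r.
rewrite !(big_nth (0, 0)) !big_mkord => sd; apply: h => //.
- by move=> i; have /and3P[] := all_nthP (0, 0) sab i (ltn_ord i).
- have disj (i j : 'I_(size s)) : (i < j)%N -> r j <= l i.
    by move=> ij; move/(pairwiseP (0, 0)): ps => /(_ i j); apply; rewrite ?inE ?ltn_ord.
  move=> i j _ _ [t []] /=; rewrite !in_itv/= => /andP[li ri] /andP[lj rj].
  by apply: val_inj; case: (ltngtP i j) => // /disj ?; exfalso; lra.
Qed.

(* A continuous induction over gauge-fine tagged partitions of [a, b].  The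
   subintervals with tag in [Z] lie in an open set of small measure, hence
   contribute little by absolute continuity; those with tag in [V] are
   charged to an open set of measure close to that of [V]. *)
Lemma absolutely_continuous_growth (R : realType) (f : R -> R) (a b c v : R)
    (Z V : set R) :
  a <= b -> 0 <= c -> absolutely_continuous_on a b f ->
  outer_lebesgue Z = 0%E -> (outer_lebesgue V <= v%:E)%E ->
  (forall x, a <= x <= b -> ~ Z x -> slope_ge f x 0) ->
  (forall x, a <= x <= b -> ~ Z x -> ~ V x -> slope_ge f x c) ->
  c * (b - a - v) <= f b - f a.
Proof.
move=> ab c0 acf Z0 Vv f0 fc.
(* The tolerance is lost three times: [c * e] for the excess measure of the open set around [V],
   [e * (b - a)] for the slopes, and [e] for the intervals tagged in [Z]. *)
suff main e : 0 < e -> c * (b - a - (v + e)) - e * (b - a) - e <= f b - f a.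
  apply/ler_addgt0Pr => e e0.
  have K0 : 0 < c + (b - a) + 1 by lra.
  have := main _ (divr_gt0 e0 K0); set e' := e / _.
  have <- : e' * (c + (b - a) + 1) = e by rewrite /e' divfK// gt_eqF.
  by nra.
move=> e0.
have [d d0 acd] := absolutely_continuous_seq acf e0.
have d20 : 0 < d / 2 by lra.
have Zle : (outer_lebesgue Z <= 0%:E)%E by rewrite Z0.
have [U [oU ZU]] := outer_lebesgue_open d20 Zle.
rewrite add0r => Ud.
(* The open set [W] covers [Z] too, so that an interval tagged in [Z] has
   [z - y - (psi z - psi y) = 0] and owes no growth at rate [c]. *)
have VZv : (outer_lebesgue (V `|` Z) <= v%:E)%E.
  apply: le_trans (outer_measureU2 _ _ _) _.
  by rewrite -(adde0 v%:E); apply: leeD; [exact: Vv|exact: Zle].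
have [W [oW VZW We]] := outer_lebesgue_open e0 VZv.
have [phi [phi0 phid phim phiU]] := open_length a oU Ud.
have [psi [psi0 psiv psim psiW]] := open_length a oW We.
(* [s] lists the intervals tagged in [Z] up to [t]. The increments of [f] over them are conceded
   here; at [b] they sum to less than [e], because [phi b <= d / 2 < d]. *)
pose P t := exists s : seq (R * R),
  [/\ all (fun p => [&& a <= p.1, p.1 <= p.2 & p.2 <= t]) s,
      pairwise (fun p q => q.2 <= p.1) s,
      \sum_(p <- s) (p.2 - p.1) <= phi t &
      c * (t - a - psi t) - e * (t - a) - \sum_(p <- s) `|f p.2 - f p.1|
        <= f t - f a].
suff [s [sab ps sphi sf]] : P b.
  have := acd s sab ps; have := phid b; have := psiv b; nra.
apply: (@segment_induction _ P a b) => //.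
  by exists [::]; rewrite !big_nil phi0 psi0; split => //; lra.
move=> x ax xb.
have axb : a <= x <= b by rewrite ax xb.
have weaken y z s : y <= z ->
    all (fun p : R * R => [&& a <= p.1, p.1 <= p.2 & p.2 <= y]) s ->
    all (fun p => [&& a <= p.1, p.1 <= p.2 & p.2 <= z]) s.
  move=> yz; apply: sub_all => p /and3P[-> -> /le_trans] /=; exact.
have [Zx|Zx] := pselect (Z x).
  have [dU dU0 gU] := open_gauge oU (ZU _ Zx).
  have [dW dW0 gW] := open_gauge oW (VZW _ (or_intror Zx)).
  exists (Num.min dU dW); first by rewrite lt_min dU0.
  move=> y z ay yx xz zb dy dz [s [sab ps sphi sf]].
  have yz := le_trans yx xz.
  have hU : `]y, z] `<=` U.
    apply: gU; [apply: le_lt_trans dy|apply: lt_le_trans dz _].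
      by rewrite lerD2l lerN2 ge_min lexx.
    by rewrite lerD2l ge_min lexx.
  have hW : `]y, z] `<=` W.
    apply: gW; [apply: le_lt_trans dy|apply: lt_le_trans dz _].
      by rewrite lerD2l lerN2 ge_min lexx orbT.
    by rewrite lerD2l ge_min lexx orbT.
  exists ((y, z) :: s); rewrite !big_cons /= ay yz lexx (weaken _ _ _ yz sab) ps.
  have := phiU _ _ ay yz hU; have := psiW _ _ ay yz hW.
  have := ler_norm (- (f z - f y)); rewrite normrN.
  split => //; last 2 first.
  - lra.
  - nra.
  by rewrite andbT; apply: sub_all sab => p /and3P[].
have step dx : 0 < dx -> (forall y z, a <= y -> y <= x -> x <= z ->
      x - dx < y -> z < x + dx -> c * (z - y - (psi z - psi y)) - e * (z - y) <=
      f z - f y) ->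
    exists2 e, 0 < e & forall y z, a <= y -> y <= x -> x <= z -> z <= b ->
      x - e < y -> z < x + e -> P y -> P z.
  move=> dx0 H; exists dx => // y z ay yx xz zb dy dz [s [sab ps sphi sf]].
  have yz := le_trans yx xz; have := H _ _ ay yx xz dy dz => H'.
  exists s; split => //; first exact: weaken sab.
  - exact: le_trans sphi (phim _ _ ay yz).
  - nra.
have [Vx|Vx] := pselect (V x).
  have [dW dW0 gW] := open_gauge oW (VZW _ (or_introl Vx)).
  have [df df0 gf] := slope_ge_gauge e0 (f0 x axb Zx).
  apply: (step (Num.min dW df)); first by rewrite lt_min dW0.
  move=> y z ay yx xz dy dz; have yz := le_trans yx xz.
  move: dy dz; rewrite ltrBlDr -ltrBlDl lt_min => /andP[y1 y2].
  rewrite -ltrBlDl lt_min => /andP[z1 z2].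
  have hW : `]y, z] `<=` W by apply: gW; lra.
  rewrite (psiW _ _ ay yz hW).
  have := gf y z yx xz; lra.
have [df df0 gf] := slope_ge_gauge e0 (fc x axb Zx Vx).
apply: (step df) => // y z ay yx xz dy dz; have yz := le_trans yx xz.
have := gf y z yx xz dy dz; have := psim _ _ ay yz; nra.
Qed.

(** The increments of [g] are charged to those of finitely many absolutely continuous functions,
    each allowed [e / D]. This serves affine changes, minima, products and coordinates alike. *)
Lemma absolutely_continuous_dominated (R : realType) (I : finType)
    (V V' : normedModType R) (a b C : R) (f : I -> R -> V) (g : R -> V') :
  (forall i, absolutely_continuous_on a b (f i)) ->
  (forall l r, a <= l -> l <= r -> r <= b ->
     `|g r - g l| <= C * \sum_i `|f i r - f i l|) ->
  absolutely_continuous_on a b g.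
Proof.
move=> acf fg e e0.
(* [C] may be negative and [I] empty, hence the maximum with 0 and the added units. *)
pose D := (Num.max C 0 + 1) * (#|I|%:R + 1).
have D0 : 0 < D.
  by rewrite mulr_gt0// ltr_wpDl// le_max lexx orbT.
have eD0 : 0 < e / D by rewrite divr_gt0.
pose d i := projT1 (cid2 (acf i _ eD0)).
exists (\big[Num.min/1]_i d i).
  by apply: lt_bigmin => // i _; rewrite /d; case: cid2.
move=> n l r lr tlr slr0.
have slr i (_ : true) : \sum_(k < n) (r k - l k) < d i.
  exact: lt_le_trans slr0 (bigmin_le _ _ _).
have fi i : \sum_(k < n) `|f i (r k) - f i (l k)| < e / D.
  have := slr i isT; rewrite /d; case: cid2 => /= di di0 H lt; exact: H.
apply: (@le_lt_trans _ _ (Num.max C 0 * \sum_i \sum_(k < n) `|f i (r k) - f i (l k)|)).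
  rewrite exchange_big /= mulr_sumr; apply: ler_sum => k _.
  have [al [lrk rb]] := lr k.
  rewrite (le_trans (fg _ _ al lrk rb))// ler_wpM2r ?sumr_ge0//.
  by rewrite le_max lexx.
apply: (@le_lt_trans _ _ (Num.max C 0 * \sum_(i : I) (e / D))).
  by rewrite ler_wpM2l// ?le_max ?lexx ?orbT//; apply: ler_sum => i _; exact: ltW.
rewrite sumr_const -mulr_natr.
have -> : Num.max C 0 * (e / D * #|I|%:R) = e * (Num.max C 0 * #|I|%:R / D).
  by ring.
rewrite -[ltRHS]mulr1 ltr_pM2l// ltr_pdivrMr// mul1r /D.
have : 0 <= Num.max C 0 by rewrite le_max lexx orbT.
have : (0 : R) <= #|I|%:R by [].
nra.
Qed.

(** * Scalar solutions: positivity and weighted growth *)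

Definition scalar_solution (R : realType) (N : nat)
    (u : 'I_N -> 'I_N -> R -> R) (y : 'I_N -> R -> R) : Prop :=
  (forall (j : 'I_N) (a b : R), 0 <= a -> a <= b ->
     absolutely_continuous_on a b (y j)) /\
  exists2 Z : set R, outer_lebesgue Z = 0%E & forall t : R, 0 < t -> ~ Z t ->
    forall j : 'I_N, is_derive t 1 (y j) (\sum_(k < N) u j k t * (y k t - y j t)).

(** The right-hand side is linear in differences of components, so it ignores [c] and scales with
    [s]. Taking [s = -1] turns upper bounds into lower bounds. *)
Lemma scalar_solution_affine (R : realType) (N : nat)
    (u : 'I_N -> 'I_N -> R -> R) (y : 'I_N -> R -> R) (c s : R) :
  scalar_solution u y -> scalar_solution u (fun j t => c + s * y j t).
Proof.
move=> [acy [Z Z0 dy]]; split.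
  move=> j a b a0 ab.
  apply: (@absolutely_continuous_dominated _ 'I_1 _ _ a b `|s| (fun=> y j)).
    by move=> _; exact: acy.
  move=> l r _ _ _; rewrite big_ord1 -normrM.
  by have -> : c + s * y j r - (c + s * y j l) = s * (y j r - y j l) by ring.
exists Z => // t t0 Zt j.
have dyj := dy t t0 Zt j.
have H : is_derive t 1 (fun t => c + s *: y j t)
  (0 + s *: (\sum_(k < N) u j k t * (y k t - y j t))) by exact: is_deriveD.
apply: is_derive_eq H _.
rewrite add0r /GRing.scale/= mulr_sumr; apply: eq_bigr => k _; ring.
Qed.

Lemma outer_lebesgueU0 (R : realType) (A B : set R) :
  outer_lebesgue A = 0%E -> outer_lebesgue B = 0%E ->
  outer_lebesgue (A `|` B) = 0%E.
Proof.
move=> A0 B0; apply/eqP; rewrite eq_le; apply/andP; split.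
  by rewrite -[leRHS]adde0 -{1}A0 -B0; exact: outer_measureU2.
exact: (@outer_measure_ge0 _ _ (@lebesgue_measure R)).
Qed.

Lemma outer_lebesgue1 (R : realType) (x : R) : outer_lebesgue [set x] = 0%E.
Proof. exact: lebesgue_measure_set1. Qed.

(* The zero set is enlarged by the point 0, where nothing is assumed. *)
Lemma scalar_solution_derive (R : realType) (N : nat)
    (u : 'I_N -> 'I_N -> R -> R) (y : 'I_N -> R -> R) :
  scalar_solution u y -> exists2 Z : set R, outer_lebesgue Z = 0%E &
    forall t : R, 0 <= t -> ~ Z t -> forall j : 'I_N,
    is_derive t 1 (y j) (\sum_(k < N) u j k t * (y k t - y j t)).
Proof.
move=> [_ [Z Z0 dy]]; exists (Z `|` [set 0]).
  by apply: outer_lebesgueU0 => //; exact: outer_lebesgue1.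
move=> t t0 /not_orP[Zt tn0]; apply: dy => //.
by rewrite lt_neqAle t0 andbT eq_sym; apply/eqP.
Qed.

(** The minimum [m] of the components has slope at least 0 off a null set: a component attaining it
    has a sum of nonnegative terms as derivative, and the other components stay above [m x] near [x]
    by continuity. *)
Lemma scalar_solution_ge0 (R : realType) (n : nat)
    (u : 'I_n -> 'I_n -> R -> R) (y : 'I_n -> R -> R) (a : R) :
  (forall j k t, 0 <= t -> 0 <= u j k t) ->
  scalar_solution u y -> 0 <= a -> (forall j, 0 <= y j a) ->
  forall j (t : R), a <= t -> 0 <= y j t.
Proof.
move=> u0 sy a0 ya j0 b ab.
pose i t := [arg min_(j < j0) y j t]%O.
have argm t j : y (i t) t <= y j t.
  by rewrite /i; case: arg_minP => // k _; exact.
pose m t := y (i t) t.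
suff : 0 * (b - a - 0) <= m b - m a.
  rewrite mul0r; have := argm b j0; have := ya (i a); rewrite /m; lra.
have [Z Z0 dy] := scalar_solution_derive sy.
suff mslope (x : R) : a <= x <= b -> ~ Z x -> slope_ge m x 0.
  apply: (@absolutely_continuous_growth _ m a b 0 0 Z set0) => //.
  - apply: (@absolutely_continuous_dominated _ 'I_n _ _ a b 1 y).
      by move=> j; exact: sy.1.
    move=> l r al lr rb; rewrite mul1r.
    have H s t j : `|y j s - y j t| <= \sum_k `|y k s - y k t|.
      by rewrite (bigD1 j)//= lerDl sumr_ge0.
    (* The minimum at one end is at most the value there of the component that is minimal at the
       other end. *)
    rewrite /m ler_norml; apply/andP; split.
      have := H l r (i r); have := argm l (i r).
      rewrite ler_norml => ? /andP[_ ?].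
      have -> : \sum_k `|y k r - y k l| = \sum_k `|y k l - y k r|.
        by apply: eq_bigr => k _; rewrite distrC.
      lra.
    have := H r l (i l); have := argm r (i l).
    by rewrite ler_norml => ? /andP[_ ?]; lra.
  - by rewrite outer_measure0.
  - by move=> x axb Zx _; exact: mslope.
move=> /andP[ax xb] Zx e e0.
have x0 := le_trans a0 ax.
have exp : \forall w \near x, forall j, `|y j w - y j x -
    (\sum_(k < n) u j k x * (y k x - y j x)) * (w - x)| <= e * `|w - x|.
  apply: (@filter_forall _ _ (fun j w => `|y j w - y j x -
    (\sum_(k < n) u j k x * (y k x - y j x)) * (w - x)| <= e * `|w - x|)
    _ (nbhs_filter x)) => j.
  by apply: is_derive_expansion => //; exact: dy.
have far : \forall w \near x, forall j, y j x <> m x -> m x < y j w.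
  apply: (@filter_forall _ _ (fun j w => y j x <> m x -> m x < y j w) _ (nbhs_filter x)) => j.
  have [->|/eqP yjm] := eqVneq (y j x) (m x); first by near=> w.
  have mlt : m x < y j x by rewrite lt_neqAle eq_sym argm andbT; exact/eqP.
  have cy : y j @ x --> y j x.
    have [+ _] := dy x x0 Zx j.
    by move=> /derivable1_diffP/differentiable_continuous; exact.
  by near=> w => _; near: w; exact: (cvgr_gt _ cy).
have D0 j : y j x = m x -> 0 <= \sum_(k < n) u j k x * (y k x - y j x).
  by move=> ->; rewrite sumr_ge0// => k _; rewrite mulr_ge0 ?u0// subr_ge0 argm.
near=> w.
have expw : forall j, `|y j w - y j x -
    (\sum_(k < n) u j k x * (y k x - y j x)) * (w - x)| <= e * `|w - x|.
  by near: w.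
have farw : forall j, y j x <> m x -> m x < y j w by near: w.
(* To the right of [x], follow the index minimal at [w]: either it was minimal at [x] as well, or
   its component has stayed above [m x]. To the left, follow the index minimal at [x]. *)
split=> xw.
  have [yj|yj] := eqVneq (y (i w) x) (m x).
    have := expw (i w); have := D0 _ yj; rewrite yj.
    by rewrite ler_norml ger0_norm ?subr_ge0// => ? /andP[? _]; rewrite {1}/m; nra.
  have := farw (i w); rewrite -/(m w) => /(_ (elimN eqP yj)); nra.
have := expw (i x); have := D0 (i x) erefl; have := argm w (i x).
rewrite -/(m w) -/(m x) ler_norml ler0_norm ?subr_le0// => ? ? /andP[_ ?].
nra.
Unshelve. all: by end_near. Qed.

Lemma expR_lip (R : realType) (x y : R) : x <= y ->
  0 <= expR y - expR x <= expR y * (y - x).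
Proof.
move=> xy; rewrite subr_ge0 ler_expR xy/=.
have -> : expR x = expR y * expR (x - y) by rewrite -expRD addrC subrK.
have := expR_ge1Dx (x - y); have := expR_gt0 y; nra.
Qed.

Lemma absolutely_continuous_id (R : realType) (a b : R) :
  absolutely_continuous_on a b (@id R).
Proof.
move=> e e0; exists e => // n l r lr _.
suff -> : \sum_(i < n) (r i - l i) = \sum_(i < n) `|id (r i) - id (l i)| by [].
by apply: eq_bigr => i _; have [_ [? _]] := lr i; rewrite ger0_norm// subr_ge0.
Qed.

(** With [E t = expR (K * (t - a))], the derivative of [E * y j] is [E] times the sum of the inflow
    [\sum_k u j k t * y k t] and [(K - U) * y j], where [U <= K] is the row sum. Since [E >= 1], it
    is at least the inflow, hence nonnegative, and at least [c] off [V]. *)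
Lemma scalar_solution_growth (R : realType) (n : nat)
    (u : 'I_n -> 'I_n -> R -> R) (y : 'I_n -> R -> R) (K a b c v : R)
    (V : set R) (j : 'I_n) :
  (forall j k t, 0 <= t -> 0 <= u j k t) ->
  (forall t, 0 <= t -> \sum_k u j k t <= K) ->
  scalar_solution u y -> 0 <= a -> a <= b -> (forall j, 0 <= y j a) ->
  0 <= c -> (outer_lebesgue V <= v%:E)%E ->
  (forall t, a <= t <= b -> ~ V t -> c <= \sum_k u j k t * y k t) ->
  c * (b - a - v) <= expR (K * (b - a)) * y j b - y j a.
Proof.
move=> u0 uK sy a0 ab ya c0 Vv cV.
have y0 k t : a <= t -> 0 <= y k t by exact: scalar_solution_ge0 u0 sy a0 ya k t.
have K0 : 0 <= K by apply: le_trans (uK a a0); rewrite sumr_ge0// => k _; exact: u0.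
(* A crude upper bound for [y j] at later times, from the nonnegativity of [M - y j]; it serves to
   make [E * y j] absolutely continuous. *)
pose M := \sum_k y k a.
have yM t : a <= t -> y j t <= M.
  have sM := @scalar_solution_affine _ _ u y M (-1) sy.
  move=> at_; suff : 0 <= M + -1 * y j t by lra.
  apply: (scalar_solution_ge0 u0 sM a0 _ j at_) => k.
  by rewrite /M (bigD1 k)//= mulN1r addrAC subrr add0r sumr_ge0.
pose E t := expR (K * (t - a)).
have -> : expR (K * (b - a)) * y j b - y j a = E b * y j b - E a * y j a.
  by rewrite /E subrr mulr0 expR0 mul1r.
have E0 t : 0 < E t by exact: expR_gt0.
have E1 t : a <= t -> 1 <= E t.
  by move=> at_; rewrite -expR0 ler_expR mulr_ge0// subr_ge0.
have [Z Z0 dy] := scalar_solution_derive sy.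
have M0 : 0 <= M by rewrite sumr_ge0.
suff slope (x d : R) : a <= x <= b -> ~ Z x -> 0 <= d ->
    d <= \sum_k u j k x * y k x -> slope_ge (fun t => E t * y j t) x d.
  apply: (@absolutely_continuous_growth _ (fun t => E t * y j t) a b c v Z V) => //.
  - apply: (@absolutely_continuous_dominated _ bool _ _ a b (E b * (1 + K * M))
        (fun i => if i then @id R else y j)).
      by case; [exact: absolutely_continuous_id|exact: sy.1].
    move=> l r al lr rb; rewrite big_bool/= (ger0_norm (x := r - l)) ?subr_ge0//.
    have Krl : K * (l - a) <= K * (r - a) by rewrite ler_wpM2l// lerB.
    have /andP[e1 e2] := expR_lip Krl.
    have Erb : E r <= E b by rewrite ler_expR ler_wpM2l// lerB.
    have -> : E r * y j r - E l * y j l =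
      E r * (y j r - y j l) + (E r - E l) * y j l by ring.
    rewrite (le_trans (ler_normD _ _))// !normrM.
    rewrite (ger0_norm (ltW (E0 r))) (ger0_norm e1) (ger0_norm (y0 _ _ al)).
    have p1 : E r * `|y j r - y j l| <= E b * `|y j r - y j l|.
      by rewrite ler_wpM2r.
    have p2 : (E r - E l) * y j l <= E b * (K * (r - l)) * M.
      apply: ler_pM => //; [exact: y0|apply: le_trans e2 _|exact: yM].
      have -> : K * (r - a) - K * (l - a) = K * (r - l) by ring.
      by rewrite ler_wpM2r// mulr_ge0// subr_ge0.
    have p3 : 0 <= E b * (r - l) by rewrite mulr_ge0 ?subr_ge0// ltW.
    have p4 : 0 <= E b * (K * M) * `|y j r - y j l|.
      by rewrite !mulr_ge0// ltW.
    rewrite -/(E r) -/(E l); lra.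
  - move=> x xab Zx; apply: slope => //; rewrite sumr_ge0// => k _.
    case/andP: xab => ax _.
    by rewrite mulr_ge0 ?y0// u0// (le_trans a0).
  - by move=> x xab Zx Vx; apply: slope => //; exact: cV.
move=> /andP[ax xb] Zx d0 dle.
have x0 := le_trans a0 ax.
have dyj := dy x x0 Zx j.
have dE : is_derive x 1 E (E x * K).
  have dl : is_derive x 1 (fun t : R => K *: (t - a)) (K *: (1 - 0)).
    by apply: is_deriveZ; exact: is_deriveB.
  have h : is_derive x 1 (expR \o (fun t : R => K *: (t - a)))
     (expR (K *: (x - a)) * (K *: (1 - 0))).
    exact: is_derive1_comp.
  by apply: is_derive_eq h _; rewrite subr0 /GRing.scale/= mulr1.
have dEy : is_derive x 1 (E * y j)
  (E x *: (\sum_(k < n) u j k x * (y k x - y j x)) + y j x *: (E x * K)).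
  exact: is_deriveM.
apply: (is_derive_slope_ge dEy); rewrite /GRing.scale/=.
have -> : \sum_(k < n) u j k x * (y k x - y j x) =
    \sum_(k < n) u j k x * y k x - (\sum_(k < n) u j k x) * y j x.
  by rewrite mulr_suml -sumrB; apply: eq_bigr => k _; rewrite mulrBr.
have := uK x x0; have := y0 j x ax; have := E1 x ax.
set S := \sum_(k < n) _ in dle *; set U := \sum_(k < n) _.
move=> Ex yj UK.
have : 0 <= E x * ((K - U) * y j x) by rewrite !mulr_ge0 ?subr_ge0// ltW.
nra.
Qed.

(** * Measure of the set where an excited function is small *)

Lemma measurable_lebesgueTypeR (R : realType) (A : set R) :
  measurable (A : set (measurableTypeR R)) ->
  measurable (A : set (lebesgueTypeR R)).
Proof. exact: sub_caratheodory. Qed.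

Lemma completed_lebesgue_itv (R : realType) (t T : R) : 0 <= T ->
  @completed_lebesgue_measure R `[t, t + T]%classic = T%:E.
Proof.
move=> T0; have := lebesgue_measure_itv `[t, (t + T)%R].
rewrite /= lte_fin => ltE; rewrite -[LHS]/(lebesgue_measure `[t, t + T]%classic) ltE.
case: ltP => [_|]; first by rewrite -EFinD addrAC subrr add0r.
by rewrite gerDl => T0'; congr EFin; apply/le_anti/andP; split.
Qed.

Lemma lebesgue_measurable_window (R : realType) (f : R -> R) (D : set R) :
  D `<=` `[0, +oo[ -> measurable (D : set (lebesgueTypeR R)) ->
  lebesgue_measurable_halfline f ->
  @measurable_fun _ _ (lebesgueTypeR R) (measurableTypeR R) D f.
Proof.
move=> D0 mD; apply: measurable_funS => //.
by apply: measurable_lebesgueTypeR; exact: measurable_itv.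
Qed.

(** Where [f < h] the integral is at most [h * T = mu / 2], so the rest [E] of the window carries at
    least [mu / 2] and, as [f <= B], has measure at least [mu / (2 * B)]. The complement [V] is what
    gets bounded, because the growth lemma takes the set where a rate may fail. *)
Lemma window_low_set (R : realType) (f : R -> R) (t T mu B : R) :
  0 <= t -> 0 < T -> 0 < mu -> 0 < B -> (forall s, 0 <= s -> 0 <= f s <= B) ->
  lebesgue_measurable_halfline f -> (mu%:E <= window_integral f t T)%E ->
  (outer_lebesgue [set s : R | (t <= s <= t + T) && (f s < mu / (2 * T))]%R
     <= (T - mu / (2 * B))%:E)%E.
Proof.
move=> t0 T0 mu0 B0 fB mf win.
set h := mu / (2 * T); set V := [set s | _].
pose I : set (lebesgueTypeR R) := `[t, t + T]%classic.
pose E : set (lebesgueTypeR R) := I `&` f @^-1` `[h, +oo[.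
pose cmu := @completed_lebesgue_measure R.
have I0 : I `<=` `[0, +oo[.
  by move=> s; rewrite /I/= !in_itv/= andbT => /andP[ts _]; lra.
have mI : measurable I by apply: measurable_lebesgueTypeR; exact: measurable_itv.
have mfI := lebesgue_measurable_window I0 mI mf.
have mE : measurable E by apply: mfI => //; exact: measurable_itv.
have VE : V = I `\` E.
  apply/seteqP; split => s; rewrite /V/I/E/= !in_itv/= ?andbT.
    by case/andP=> H fh; split=> // -[_]; lra.
  by case=> H nE; rewrite H/= ltNge; apply/negP => fh; apply: nE.
have mV : measurable (V : set (lebesgueTypeR R)) by rewrite VE; exact: measurableD.
have IUE : I = V `|` E.
  by rewrite VE setUC setDUK//; exact: subIsetl.
have dVE : V `&` E = set0 by rewrite VE setDE -setIA setICl setI0.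
have ITe : cmu V + cmu E = T%:E :> \bar R.
  have := completed_lebesgue_itv t (ltW T0).
  by rewrite -/I IUE => <-; rewrite -measureU.
have finV : cmu V \is a fin_num.
  rewrite ge0_fin_numE//; have : (cmu V <= T%:E)%E by rewrite -ITe leeDl.
  by move=> /le_lt_trans; apply; rewrite ltry.
have finE : cmu E \is a fin_num.
  rewrite ge0_fin_numE//; have : (cmu E <= T%:E)%E by rewrite -ITe leeDr.
  by move=> /le_lt_trans; apply; rewrite ltry.
have intle (D : set (lebesgueTypeR R)) (c : R) : D `<=` I -> measurable D -> 0 <= c ->
    (forall s, D s -> f s <= c) -> (\int[cmu]_(s in D) (f s)%:E <= c%:E * cmu D)%E.
  move=> DI mD c0 fc; rewrite -integral_cst//.
  apply: ge0_le_integral => //.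
  - by move=> s Ds; rewrite lee_fin; have := I0 _ (DI _ Ds);
      rewrite /= in_itv/= andbT => /fB/andP[].
  - apply/measurable_EFinP.
    by apply: lebesgue_measurable_window mf => //; exact: subset_trans DI I0.
have h0 : 0 < h by rewrite divr_gt0// mulr_gt0.
have leV : (\int[cmu]_(s in V) (f s)%:E <= h%:E * cmu V)%E.
  apply: intle => //; [by rewrite IUE; exact: subsetUl|exact: ltW|].
  by move=> s /andP[_ /ltW].
have leE : (\int[cmu]_(s in E) (f s)%:E <= B%:E * cmu E)%E.
  apply: intle => //; [by rewrite IUE; exact: subsetUr|exact: ltW|].
  by move=> s [/I0 + _]; rewrite /= in_itv/= andbT => /fB/andP[].
have split_int : window_integral f t T =
    (\int[cmu]_(s in V) (f s)%:E + \int[cmu]_(s in E) (f s)%:E)%E.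
  rewrite /window_integral -/I -/cmu IUE ge0_integral_setU//.
  - by rewrite -IUE; exact/measurable_EFinP.
  - rewrite -IUE => s /I0; rewrite /= in_itv/= andbT => /fB/andP[+ _].
    by rewrite lee_fin.
  - by rewrite disj_set2E dVE.
have : (mu%:E <= h%:E * cmu V + B%:E * cmu E)%E.
  by rewrite (le_trans win)// split_int leeD.
(* The completed Lebesgue measure unfolds to the outer measure. *)
change (outer_lebesgue V) with (cmu V).
move: ITe; rewrite -(fineK finV) -(fineK finE) -!EFinM -!EFinD.
case=> ITe; rewrite !lee_fin.
have : 0 <= fine (cmu V) by rewrite fine_ge0.
have : 0 <= fine (cmu E) by rewrite fine_ge0.
set a := fine (cmu V) in ITe *; set b := fine (cmu E) in ITe *.
move=> b0 a0 H.
have hT : h * T = mu / 2 by rewrite /h; field; rewrite gt_eqF.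
have muB : mu / (2 * B) * B = mu / 2 by field; rewrite gt_eqF.
rewrite -(ler_pM2r B0) mulrBl muB; nra.
Qed.

(** * Propagation of lower bounds along paths of the graph *)

(** Delay and constant are uniform in the starting time and the solution. The exponential weight
    lets the bound hold at every later [t], hence over a whole window when it is passed on to the
    next node. *)
Definition influences (R : realType) (N : nat) (u : 'I_N -> 'I_N -> R -> R)
    (K : R) (l i : 'I_N) : Prop :=
  exists delay kappa : R, [/\ 0 <= delay, 0 < kappa &
    forall (y : 'I_N -> R -> R) (a t : R), scalar_solution u y ->
      0 <= a -> (forall j, 0 <= y j a) -> a + delay <= t ->
      kappa * y l a <= expR (K * (t - a)) * y i t].

Lemma scalar_solution_decay (R : realType) (N : nat)
    (u : 'I_N -> 'I_N -> R -> R) (y : 'I_N -> R -> R) (K a t : R) (j : 'I_N) :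
  (forall j k t, 0 <= t -> 0 <= u j k t) ->
  (forall j t, 0 <= t -> \sum_k u j k t <= K) ->
  scalar_solution u y -> 0 <= a -> a <= t -> (forall j, 0 <= y j a) ->
  y j a <= expR (K * (t - a)) * y j t.
Proof.
move=> u0 uK sy a0 at_ ya; rewrite -subr_ge0.
suff : 0 * (t - a - 0) <= expR (K * (t - a)) * y j t - y j a by rewrite mul0r.
apply: (scalar_solution_growth (V := set0) u0 (uK j) sy) => //.
  by rewrite outer_measure0.
move=> s /andP[as_ _] _; rewrite sumr_ge0// => k _.
have s0 := le_trans a0 as_.
by rewrite mulr_ge0 ?u0//; exact: scalar_solution_ge0 u0 sy a0 ya k s as_.
Qed.

(** Over the window from [s = a + d] to [s + T], [y k] is at least [eta], and [u i k >= h] outside a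
    set of measure at most [T - mu / (2 * B)]. So the weighted [y i] reaches
    [h * eta * (mu / (2 * B))] at the end of the window, and the weight preserves this
    afterwards. *)
Lemma influences_step (R : realType) (N : nat) (u : 'I_N -> 'I_N -> R -> R)
    (K B : R) (l i k : 'I_N) :
  0 < B -> (forall j k t, 0 <= t -> 0 <= u j k t <= B) ->
  (forall j t, 0 <= t -> \sum_k u j k t <= K) ->
  lebesgue_measurable_halfline (u i k) -> excited_uniform (u i k) ->
  influences u K l k -> influences u K l i.
Proof.
move=> B0 uB uK mu_ik [T [mu [T0 mu0 win]]] [d [c [d0 c0 Hk]]].
have u0 j m t : 0 <= t -> 0 <= u j m t by move=> /(uB j m)/andP[].
pose h := mu / (2 * T).
have h0 : 0 < h by rewrite divr_gt0// mulr_gt0.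
have g0 : 0 < mu / (2 * B) by rewrite divr_gt0// mulr_gt0.
exists (d + T), (h * (c * expR (- (K * (d + T)))) * (mu / (2 * B))); split.
- by rewrite addr_ge0// ltW.
- by rewrite mulr_gt0// mulr_gt0// mulr_gt0// expR_gt0.
move=> y a t sy a0 ya adt.
have y0 j s : a <= s -> 0 <= y j s by exact: scalar_solution_ge0 u0 sy a0 ya j s.
have K0 : 0 <= K by apply: le_trans (uK i a a0); rewrite sumr_ge0// => m _; exact: u0.
pose s := a + d.
have as_ : a <= s by rewrite lerDl.
have s0 : 0 <= s by exact: le_trans as_.
have asT : a <= s + T by rewrite (le_trans as_)// lerDl ltW.
have sTt : s + T <= t by rewrite /s -addrA.
(* Within the window [w - a <= d + T]; dividing by the largest weight gives a bound that does not
   depend on [w]. *)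
pose eta := c * expR (- (K * (d + T))) * y l a.
have eta0 : 0 <= eta by rewrite !mulr_ge0 ?ya ?expR_ge0// ltW.
have yk w : s <= w <= s + T -> eta <= y k w.
  move=> /andP[sw wsT].
  have aw := le_trans as_ sw.
  have le_exp : expR (K * (w - a)) <= expR (K * (d + T)).
    by rewrite ler_expR ler_wpM2l//; rewrite /s in wsT; lra.
  rewrite /eta -(ler_pM2l (expR_gt0 (K * (d + T)))).
  have -> : expR (K * (d + T)) * (c * expR (- (K * (d + T))) * y l a) = c * y l a.
    by rewrite expRN; field; rewrite gt_eqF// expR_gt0.
  by rewrite (le_trans (Hk y a w sy a0 ya sw))// ler_wpM2r// y0.
have low := window_low_set s0 T0 mu0 B0 (uB i k) mu_ik (win s s0).
have push := scalar_solution_growth (c := h * eta) (K := K) (j := i) (b := s + T)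
  u0 (uK i) sy s0 _ (fun j => y0 j s as_) _ low _.
have {}push : h * eta * (mu / (2 * B)) <= expR (K * T) * y i (s + T).
  have ysi := y0 i s as_.
  have eqT : s + T - s - (T - mu / (2 * B)) = mu / (2 * B) by ring.
  have eqK : s + T - s = T by ring.
  move: push; rewrite eqT eqK => push; apply: le_trans (push _ _ _) _.
  - by rewrite lerDl ltW.
  - by rewrite mulr_ge0// ltW.
  - move=> w sw /negP; rewrite sw/= -leNgt => hu.
    have sw' := sw; case/andP: sw' => sw' _.
    have w0 := le_trans s0 sw'.
    apply: le_trans (ler_pM (ltW h0) eta0 hu (yk w sw)) _.
    rewrite (bigD1 k)//= lerDl sumr_ge0// => m _.
    by rewrite mulr_ge0 ?u0// y0// (le_trans as_).
  - by rewrite gerBl.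
have sT0 : 0 <= s + T by rewrite addr_ge0// ltW.
have dec := scalar_solution_decay i u0 uK sy sT0 sTt (fun j => y0 j _ asT).
have -> : h * (c * expR (- (K * (d + T)))) * (mu / (2 * B)) * y l a =
  h * eta * (mu / (2 * B)) by rewrite /eta; ring.
apply: le_trans push _.
have yt : 0 <= y i t by apply: y0; exact: le_trans sTt.
apply: (@le_trans _ _ (expR (K * T) * (expR (K * (t - (s + T))) * y i t))).
  by rewrite ler_wpM2l// expR_ge0.
rewrite mulrA -expRD ler_wpM2r// ler_expR -mulrDr ler_wpM2l//.
rewrite /s; lra.
Qed.

Lemma influences_connect (R : realType) (N : nat) (u : 'I_N -> 'I_N -> R -> R)
    (K B : R) (l i : 'I_N) (e : rel 'I_N) :
  0 < B -> (forall j k t, 0 <= t -> 0 <= u j k t <= B) ->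
  (forall j t, 0 <= t -> \sum_k u j k t <= K) ->
  (forall j k, lebesgue_measurable_halfline (u j k)) ->
  (forall j k, e j k -> excited_uniform (u j k)) ->
  connect e i l -> influences u K l i.
Proof.
move=> B0 uB uK mfu eu /connectP[p ep lp].
have u0 j m t : 0 <= t -> 0 <= u j m t by move=> /(uB j m)/andP[].
elim: p i ep lp => [|k p IH] i /=; last first.
  move=> /andP[eik pk] lp.
  by apply: (influences_step B0 uB uK (mfu i k) (eu _ _ eik)); exact: IH.
move=> _ ->; exists 0, 1; split => // y a t sy a0 ya; rewrite addr0 mul1r => at_.
exact: scalar_solution_decay u0 uK sy a0 at_ ya.
Qed.

(** The sum of the delays is at least each of them and serves all nodes, with the smallest of the
    constants. At this fixed delay the weight is the constant [expR (K * D)] and can be divided out;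
    including 1 in the minimum gives [kappa <= 1]. *)
Lemma scalar_solution_mixing (R : realType) (N : nat)
    (u : 'I_N -> 'I_N -> R -> R) (K : R) (l : 'I_N) :
  0 <= K -> (forall i, influences u K l i) ->
  exists delay kappa : R, [/\ 0 <= delay, 0 < kappa, kappa <= 1 &
    forall (y : 'I_N -> R -> R) (a : R), scalar_solution u y -> 0 <= a ->
      (forall j, 0 <= y j a) -> forall i, kappa * y l a <= y i (a + delay)].
Proof.
move=> K0 inf.
have [d Hd] := choice inf.
have [c Hc] := choice Hd.
pose D := \sum_i d i.
have D0 : 0 <= D by rewrite sumr_ge0// => i _; have [] := Hc i.
pose C := \big[Num.min/1]_i c i.
have C0 : 0 < C by apply: lt_bigmin => // i _; have [] := Hc i.
exists D, (C * expR (- (K * D))); split => //.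
- by rewrite mulr_gt0// expR_gt0.
- rewrite mulr_ile1 ?expR_ge0 ?(ltW C0)//; first exact: bigmin_le_id.
  by rewrite -[leRHS]expR0 ler_expR oppr_le0 mulr_ge0.
move=> y a sy a0 ya i.
have [di ci H] := Hc i.
have diD : d i <= D.
  by rewrite /D (bigD1 i)//= lerDl sumr_ge0// => k _; have [] := Hc k.
have {}H : c i * y l a <= expR (K * D) * y i (a + D).
  by have := H y a (a + D) sy a0 ya; rewrite lerD2l [a + D - a]addrAC subrr add0r; exact.
rewrite -(ler_pM2l (expR_gt0 (K * D))); apply: le_trans H.
have -> : expR (K * D) * (C * expR (- (K * D)) * y l a) = C * y l a.
  by rewrite expRN; field; rewrite gt_eqF// expR_gt0.
by rewrite ler_wpM2r ?ya// bigmin_le.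
Qed.

(** * Contraction of the range and scalar consensus *)

Lemma scalar_solution_between (R : realType) (N : nat)
    (u : 'I_N -> 'I_N -> R -> R) (x : 'I_N -> R -> R) (a m M : R) :
  (forall j k t, 0 <= t -> 0 <= u j k t) -> scalar_solution u x -> 0 <= a ->
  (forall j, m <= x j a <= M) -> forall j t, a <= t -> m <= x j t <= M.
Proof.
move=> u0 sx a0 xa j t at_; apply/andP; split.
  have := scalar_solution_ge0 u0 (scalar_solution_affine (- m) 1 sx) a0 _ j at_.
  by rewrite mul1r addrC subr_ge0; apply => k; case/andP: (xa k); lra.
have := scalar_solution_ge0 u0 (scalar_solution_affine M (-1) sx) a0 _ j at_.
by rewrite mulN1r subr_ge0; apply => k; case/andP: (xa k); lra.
Qed.

(** If [x l a] lies in the lower half, then [M - x l a >= (M - m) / 2], and mixing applied to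
    [M - x] lowers the upper end by [kappa / 2 * (M - m)]. Otherwise mixing applied to [x - m]
    raises the lower end by as much. *)
Lemma scalar_solution_contraction (R : realType) (N : nat)
    (u : 'I_N -> 'I_N -> R -> R) (x : 'I_N -> R -> R) (l : 'I_N)
    (delay kappa a m M : R) :
  (forall j k t, 0 <= t -> 0 <= u j k t) -> 0 <= delay -> 0 < kappa ->
  (forall (y : 'I_N -> R -> R) (a : R), scalar_solution u y -> 0 <= a ->
      (forall j, 0 <= y j a) -> forall i, kappa * y l a <= y i (a + delay)) ->
  scalar_solution u x -> 0 <= a -> (forall j, m <= x j a <= M) ->
  exists m' M', M' - m' = (1 - kappa / 2) * (M - m) /\
    forall j, m' <= x j (a + delay) <= M'.
Proof.
move=> u0 d0 k0 mix sx a0 xa.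
have xt j : m <= x j (a + delay) <= M.
  by apply: (scalar_solution_between u0 sx a0 xa); rewrite lerDl.
have [mid|mid] := leP (x l a) ((m + M) / 2).
  exists m, (M - kappa / 2 * (M - m)); split; first by ring.
  move=> j.
  have := mix _ a (scalar_solution_affine M (-1) sx) a0 _ j.
  have h k : 0 <= M + -1 * x k a by have := xa k; lra.
  by move=> /(_ h) H; have := xt j; nra.
exists (m + kappa / 2 * (M - m)), M; split; first by ring.
move=> j.
have := mix _ a (scalar_solution_affine (- m) 1 sx) a0 _ j.
have h k : 0 <= - m + 1 * x k a by have := xa k; lra.
by move=> /(_ h) H; have := xt j; nra.
Qed.

(** Iterating the contraction gives ranges of length [q ^+ n * (A + A)], which tends to 0. The limit
    is taken as the supremum of the eventual lower bounds of [x l], which lies in every such range,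
    so that no sequence of ranges has to be chosen. *)
Lemma scalar_solution_consensus (R : realType) (N : nat)
    (u : 'I_N -> 'I_N -> R -> R) (x : 'I_N -> R -> R) (l : 'I_N)
    (delay kappa : R) :
  (forall j k t, 0 <= t -> 0 <= u j k t) -> 0 <= delay -> 0 < kappa ->
  kappa <= 1 ->
  (forall (y : 'I_N -> R -> R) (a : R), scalar_solution u y -> 0 <= a ->
      (forall j, 0 <= y j a) -> forall i, kappa * y l a <= y i (a + delay)) ->
  scalar_solution u x ->
  exists xstar : R, forall j, x j t @[t --> +oo] --> xstar.
Proof.
move=> u0 d0 k0 k1 mix sx.
pose A := \sum_j `|x j 0|.
pose q := 1 - kappa / 2.
have shrink n : exists m M, M - m = q ^+ n * (A + A) /\
    forall j t, delay * n%:R <= t -> m <= x j t <= M.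
  elim: n => [|n [m [M [mM H]]]].
    exists (- A), A; rewrite expr0 mul1r opprK mulr0; split => // j t.
    apply: (scalar_solution_between u0 sx) => // k.
    rewrite -ler_norml /A (bigD1 k)//= lerDl sumr_ge0//.
  have dn0 : 0 <= delay * n%:R by rewrite mulr_ge0.
  have [|m' [M' [mM' H']]] :=
    scalar_solution_contraction u0 d0 k0 mix sx dn0 (m := m) (M := M).
    by move=> j; exact: H.
  exists m', M'; rewrite mM' mM exprS mulrA; split => // j t.
  rewrite -natr1 mulrDr mulr1 => dt.
  by apply: (scalar_solution_between u0 sx _ H') => //; rewrite addr_ge0.
pose L := [set m | exists n : nat, forall t, delay * n%:R <= t -> m <= x l t].
have L0 : L !=set0.
  have [m [M [_ H]]] := shrink 0%N.
  by exists m, 0%N => t /(H l)/andP[].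
have Lub n m M : (forall j t, delay * n%:R <= t -> m <= x j t <= M) -> ubound L M.
  move=> H m' [n' H']; pose t := Num.max (delay * n%:R) (delay * n'%:R).
  apply: le_trans (H' t _) _; first by rewrite le_max lexx orbT.
  have nt : delay * n%:R <= t by rewrite le_max lexx.
  by have /andP[] := H l t nt.
have hL : has_sup L.
  split => //; have [m [M [_ H]]] := shrink 0%N; exists M; exact: Lub H.
exists (sup L) => j; apply/cvgrPdist_le => e e0.
have q1 : `|q| < 1 by rewrite /q ger0_norm; lra.
have : q ^+ n * (A + A) @[n --> \oo] --> (0 : R).
  by rewrite -(mul0r (A + A)); apply: cvgMr_tmp; exact: cvg_expr.
move/cvgrPdist_le => /(_ _ e0)[n _ /(_ n (leqnn n))] /=.
rewrite sub0r normrN => small.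
have [m [M [mM H]]] := shrink n.
near=> t.
have /andP[mx xM] : m <= x j t <= M.
  by apply: H; near: t; apply: nbhs_pinfty_ge; exact: num_real.
have mL : m <= sup L.
  by apply: ub_le_sup hL.2 _ _; exists n => s /(H l)/andP[].
have LM : sup L <= M by apply: ge_sup => //; exact: Lub H.
rewrite -mM in small; have := le_trans (ler_norm _) small.
by rewrite ler_norml => ?; apply/andP; split; lra.
Unshelve. all: by end_near. Qed.

(** * Equivalence of the excitation conditions *)

Lemma window_integral_le (R : realType) (f : R -> R) (t T t' T' : R) :
  (forall s, 0 <= s -> 0 <= f s) -> lebesgue_measurable_halfline f ->
  0 <= t' -> t' <= t -> t + T <= t' + T' ->
  (window_integral f t T <= window_integral f t' T')%E.
Proof.
move=> f0 mf t'0 tt' TT'.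
have I0 : `[t', t' + T']%classic `<=` `[0, +oo[.
  by move=> s; rewrite /= !in_itv/= andbT => /andP[ts _]; lra.
apply: ge0_subset_integral => //.
- by apply: measurable_lebesgueTypeR; exact: measurable_itv.
- by apply: measurable_lebesgueTypeR; exact: measurable_itv.
- apply/measurable_EFinP; apply: lebesgue_measurable_window mf => //.
  by apply: measurable_lebesgueTypeR; exact: measurable_itv.
- by move=> s /I0; rewrite /= in_itv/= andbT lee_fin; exact: f0.
- by move=> s; rewrite /= !in_itv/=; lra.
Qed.

(** A positive limsup yields one length [T] with positive liminf in [t], hence a bound past some
    [M]; a longer window reaches past [M] from every [t >= 0]. Conversely, window integrals increase
    with the length, so a uniform bound persists for all larger lengths. *)
Lemma excited_limsupP (R : realType) (f : R -> R) :
  (forall s, 0 <= s -> 0 <= f s) -> lebesgue_measurable_halfline f ->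
  excited_limsup f <-> excited_uniform f.
Proof.
move=> f0 mf; split; last first.
  move=> [T [mu [T0 mu0 H]]].
  apply: (@lt_le_trans _ _ mu%:E); first by rewrite lte_fin.
  rewrite limf_esupE; apply: le_ereal_inf_tmp => _ [V [M [Mr MV]] <-].
  (* A length in the given neighbourhood of [+oo] that is also at least [T]. *)
  pose T' := Num.max T (M + 1).
  apply: le_ereal_sup_tmp.
  exists (limf_einf (window_integral f ^~ T') (pinfty_nbhs R)).
    by exists T' => //; apply: MV; rewrite lt_max; apply/orP; right; lra.
  rewrite limf_einfE; apply: le_ereal_sup_tmp.
  exists (ereal_inf (window_integral f ^~ T' @` [set t | 0 <= t])).
    exists [set t | 0 <= t] => //.
    by exists 0; split; [exact: num_real|move=> t /ltW].
  apply: le_ereal_inf_tmp => _ [t /= t0 <-]; apply: le_trans (H t t0) _.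
  by apply: window_integral_le => //; rewrite lerD2l le_max lexx.
rewrite /excited_limsup => H.
have : (0 < ereal_sup ((fun T => limf_einf (window_integral f ^~ T) (pinfty_nbhs R))
    @` [set T | (0 < T)%R]))%E.
  apply: lt_le_trans H _; rewrite limf_esupE; apply: ereal_inf_lbound.
  by exists [set T : R | 0 < T] => //; exists 0; split; first exact: num_real.
move=> /ereal_sup_gt[_ [T /= T0 <-]].
rewrite limf_einfE => /ereal_sup_gt[_ [V [M [Mr MV]] <-]] inf0.
have [mu mu0 infmu] : exists2 mu : R, 0 < mu &
    (mu%:E <= ereal_inf (window_integral f ^~ T @` V))%E.
  (* The infimum may be [+oo], in which case [mu = 1] is taken. *)
  case: (ereal_inf _) inf0 => [r|_|//]; first by rewrite lte_fin; exists r.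
  by exists 1 => //; exact: leey.
pose A := Num.max M 0 + 1.
have A0 : 0 < A by rewrite ltr_wpDl// le_max lexx orbT.
exists (A + T), mu; split => //; first by rewrite addr_gt0.
move=> t t0; apply: le_trans infmu _.
apply: (@le_trans _ _ (window_integral f (t + A) T)).
  apply: ereal_inf_lbound; exists (t + A) => //; apply: MV.
  have : M <= Num.max M 0 by rewrite le_max lexx.
  rewrite /A; lra.
by apply: window_integral_le => //; lra.
Qed.

(** The integers serve as the sequence in one direction. In the other, bounded gaps put some [t_ n]
    between [t] and [t + B], so the window of length [B + T] from [t] contains the one of length [T]
    from [t_ n]. *)
Lemma excited_sequenceP (R : realType) (f : R -> R) :
  (forall s, 0 <= s -> 0 <= f s) -> lebesgue_measurable_halfline f ->
  excited_uniform f <-> excited_sequence f.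
Proof.
move=> f0 mf; split.
  move=> [T [mu [T0 mu0 H]]]; exists T, mu, (fun n => n%:R); split.
    by split => // ; exact: cvgr_idn.
  split; last by move=> n; apply: H.
  exists 1; split; first exact: num_real.
  by move=> M M1 n _ /=; rewrite -natr1 addrAC subrr add0r normr1 ltW.
move=> [T [mu [t_ [[T0 mu0 t0 ct] [[M [Mr MB]] H]]]]].
have {MB}MB n : t_ n.+1 - t_ n <= M + 1.
  have := MB (M + 1) _ n I; rewrite ltrDl ltr01 => /(_ isT).
  exact: le_trans (ler_norm _).
(* The first [t_ n] at or after [t] may be [t_ 0], which has no predecessor to compare with; hence
   the maximum. *)
pose B := Num.max (M + 1) (t_ 0%N).
have B0 : 0 <= B by rewrite le_max t0 orbT.
exists (B + T), mu; split => //; first by rewrite ltr_wpDl.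
move=> t tge0.
have [n [tn nt]] : exists n, t <= t_ n /\ t_ n <= t + B.
  have ex : exists n, t <= t_ n.
    have /cvgryPge/(_ t)[n _ /(_ n (leqnn n))] := ct; by exists n.
  case: (ex_minnP ex) => -[|n] tn nmin.
    by exists 0%N; split => //; rewrite ler_wpDl// le_max lexx orbT.
  exists n.+1; split => //.
  have : t_ n < t by rewrite ltNge; apply/negP => /nmin; rewrite ltnn.
  have := MB n; have : M + 1 <= B by rewrite le_max lexx.
  lra.
apply: le_trans (H n) _.
by apply: window_integral_le => //; lra.
Qed.

(** * Reduction to coordinates and conclusion *)

Lemma caratheodory_solution_coord (R : realType) (N d : nat)
    (u : 'I_N -> 'I_N -> R -> R) (x : 'I_N -> R -> 'rV[R]_d) (i : 'I_d) :
  caratheodory_solution u x ->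
  scalar_solution u (fun j t => x j t ord0 i).
Proof.
move=> [acx [Z [mZ Z0 sub]]]; split.
  move=> j a b a0 ab.
  apply: (@absolutely_continuous_dominated _ 'I_1 _ _ a b 1 (fun=> x j)).
    by move=> _; exact: acx.
  move=> l r _ _ _; rewrite big_ord1 mul1r.
  rewrite [leRHS]/Num.Def.normr/= mx_normrE.
  apply: le_trans; last exact: (le_bigmax _ _ (ord0, i)).
  by rewrite !mxE.
exists Z => // t t0 Zt j.
have [dx Dx] : is_derive t 1 (x j) (\sum_(k < N) u j k t *: (x k t - x j t)).
  (* [sub] places every time at which the equation fails inside [Z]. *)
  by apply: contrapT => nd; apply: Zt; apply: sub => /(_ t0 j).
have dxi := (derivable_mxP _ _ _).1 dx ord0 i.
apply: DeriveDef => //.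
have := derive_mx dx; rewrite Dx => /(congr1 (fun v : 'rV_d => v ord0 i)).
rewrite mxE => <-; rewrite summxE; apply: eq_bigr => k _.
by rewrite !mxE.
Qed.

Lemma cvg_row (R : realType) (d : nat) (f : R -> 'rV[R]_d) (l : 'rV[R]_d)
    (F : set_system R) {FF : Filter F} :
  (forall i, f t ord0 i @[t --> F] --> l ord0 i) -> f t @[t --> F] --> l.
Proof.
move=> fl; apply/cvgrPdist_le => e e0.
have : \forall t \near F, forall i, `|l ord0 i - f t ord0 i| <= e.
  by apply: filter_forall => i; exact: ((cvgrPdist_le _ _).1 (fl i)).
apply: filterS => t H.
rewrite /Num.Def.normr/= mx_normrE (bigmax_le _ (ltW e0))//= => -[k i] _.
by rewrite !mxE ord1.
Qed.

Lemma bounded_family (R : realType) (N : nat) (u : 'I_N -> 'I_N -> R -> R) :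
  (forall (j k : 'I_N) (t : R), 0 <= t -> 0 <= u j k t) ->
  (forall j k : 'I_N, [bounded u j k t | t in `[0, +oo[%classic]) ->
  exists2 B : R, 0 < B & forall j k t, 0 <= t -> 0 <= u j k t <= B.
Proof.
move=> u0 ub.
have : \forall M \near +oo, forall jk : 'I_N * 'I_N, forall t,
    `[0, +oo[%classic t -> `|u jk.1 jk.2 t| <= M.
  by apply: filter_forall => -[j k]; exact: ub.
move=> [M [Mr H]]; exists (Num.max M 0 + 1).
  by rewrite ltr_wpDl// le_max lexx orbT.
move=> j k t t0; rewrite u0//=; apply: le_trans (ler_norm _) _.
apply: (H _ _ (j, k)); last by rewrite /= in_itv/= t0.
have : M <= Num.max M 0 by rewrite le_max lexx.
lra.
Qed.

Theorem corollary5 (R : realType) (N d : nat) (u : 'I_N -> 'I_N -> R -> R)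
    (hN : (1 <= N)%N) (hd : (1 <= d)%N)
    (u_ge0 : forall (j k : 'I_N) (t : R), 0 <= t -> 0 <= u j k t)
    (u_meas : forall j k : 'I_N, lebesgue_measurable_halfline (u j k))
    (u_bnd : forall j k : 'I_N, [bounded u j k t | t in `[0, +oo[%classic]) :
  (forall j k : 'I_N,
     (excited_limsup (u j k) <-> excited_uniform (u j k)) /\
     (excited_uniform (u j k) <-> excited_sequence (u j k))) /\
  ((exists l : 'I_N, globally_reachable (fun j k => excited (u j k)) l) ->
   forall (x0 : 'I_N -> 'rV[R]_d) (x : 'I_N -> R -> 'rV[R]_d),
     caratheodory_solution u x ->
     (forall j : 'I_N, x j 0 = x0 j) ->
     converges_to_consensus x).
Proof.
have eqv j k : (excited_limsup (u j k) <-> excited_uniform (u j k)) /\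
    (excited_uniform (u j k) <-> excited_sequence (u j k)).
  split; first exact: excited_limsupP (u_ge0 j k) _.
  exact: excited_sequenceP (u_ge0 j k) _.
split=> // -[l reach] _ x sx _.
have [B B0 uB] := bounded_family u_ge0 u_bnd.
pose K := B *+ N.
have uK j t : 0 <= t -> \sum_k u j k t <= K.
  move=> t0; rewrite /K -[in leRHS](card_ord N) -sumr_const; apply: ler_sum => k _.
  by have /andP[] := uB j k t t0.
have infl i : influences u K l i.
  apply: (influences_connect B0 uB uK u_meas _ (reach i)) => j k /asboolP.
  have [[lu _] [_ su]] := eqv j k.
  by case=> [/lu|//|/su].
have K0 : 0 <= K by rewrite mulrn_wge0// ltW.
have [delay [kappa [d0 k0 k1 mix]]] := scalar_solution_mixing K0 infl.
have cons (i : 'I_d) : exists xs : R, forall j, x j t ord0 i @[t --> +oo] --> xs.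
  apply: (scalar_solution_consensus u_ge0 d0 k0 k1 mix).
  exact: caratheodory_solution_coord.
have [xs Hxs] := choice cons.
exists (\row_i xs i) => j; apply: cvg_row => i.
by rewrite mxE; exact: Hxs.
Qed.
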